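(* Let $K$ be a finite $k$-dimensional simplicial complex with $k\ge1$, let $D$ be the maximum upper degree of a ridge of $K$, and let $\rho$ be a ridge of degree $D$. Then $\rho$ is clean if and only if $Sx_\rho=(D-1)x_\rho$, where $S=S(K)$ is the signed facet-adjacency matrix and $x_\rho$ is the fan vector of $\rho$. Consequently, if $\lambda_1(L^{\mathrm{up}}_{k-1}(K))=D+k$, then every ridge of degree $D$ is clean.
   Context: A simplicial complex $K$ on a finite vertex set is a collection of subsets closed under taking subsets; a face with $m+1$ vertices has dimension $m$, and $K_j$ is the set of $j$-dimensional faces; $K$ is $k$-dimensional if $k$ is the largest dimension of a face. The $k$-faces are called facets and the $(k-1)$-faces ridges. The (upper) degree of a ridge $\rho$ is $d(\rho)=|\{F\in K_k:\rho\subset F\}|$. Choose an orientation (an ordering of the vertices, up to even permutations) of each face. The boundary matrix $B_k=([\sigma:F])_{\sigma\in K_{k-1},F\in K_k}$ has $[\sigma:F]=0$ if $\sigma\not\subset F$, and if $F=[v_0,\dots,v_k]$ and $\sigma=F\setminus\{v_i\}$ then $[\sigma:F]=(-1)^i\operatorname{sgn}(\pi)$, where $\pi$ is the permutation carrying $(v_0,\dots,\widehat{v_i},\dots,v_k)$ to the chosen ordering of $\sigma$. The up-Laplacian is $L^{\mathrm{up}}_{k-1}(K)=B_kB_k^{\mathsf T}$, and $\lambda_1$ denotes the largest eigenvalue. Two distinct facets $F,G$ are adjacent if they share a ridge $R=F\cap G$; then $\varepsilon(F,G)=[R:F][R:G]\in\{\pm1\}$. $S=S(K)$ is the symmetric matrix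 indexed by $K_k$ with zero diagonal, $S_{F,G}=\varepsilon(F,G)$ if $F,G$ are adjacent, and $S_{F,G}=0$ otherwise. For a ridge $\rho$ of degree $D$, its fan is $\mathcal F_\rho=\{F\in K_k:\rho\subset F\}$, and its fan vector $x_\rho\in\mathbb R^{K_k}$ has $(x_\rho)_F=[\rho:F]$ if $\rho\subset F$ and $(x_\rho)_F=0$ otherwise. The ridge $\rho$ is clean if every facet outside $\mathcal F_\rho$ is adjacent to either zero or two members of $\mathcal F_\rho$. *)

(* Defs.v *)
From mathcomp Require Import all_boot all_order all_fingroup all_algebra.
From mathcomp Require Import reals.
Set Implicit Arguments.
Unset Strict Implicit.
Unset Printing Implicit Defensive.
Import Order.TTheory GRing.Theory Num.Theory.
Local Open Scope ring_scope.

Section SimplicialComplexes.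
Variable T : finType.
Implicit Types (K : {set {set T}}) (F G s t : {set T}) (k : nat).

Definition simplicial_complex K : Prop :=
  forall s t, s \in K -> t \subset s -> t \in K.

(* K_j *)
Definition faces K (j : nat) : {set {set T}} := [set s in K | #|s| == j.+1].

Definition has_dim K k : Prop :=
  (exists F, F \in faces K k) /\ (forall s, s \in K -> (#|s| <= k.+1)%N).

(* For k >= 1, the facets are faces K k and the ridges are faces K k.-1. *)
Definition fan K k (rho : {set T}) : {set {set T}} :=
  [set F in faces K k | rho \subset F].

Definition upper_degree K k (rho : {set T}) : nat := #|fan K k rho|.

Definition max_upper_degree K k : nat :=
  \max_(rho in faces K k.-1) upper_degree K k rho.

Definition adjacent K k F G : bool :=
  (F != G) && (F :&: G \in faces K k.-1).

Definition clean K k (rho : {set T}) : Prop :=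
  forall F, F \in faces K k -> F \notin fan K k rho ->
    let m := #|[set G in fan K k rho | adjacent K k F G]| in
    m = 0%N \/ m = 2%N.

(* The orientation of a face s is represented by an ordering o s of its
   vertices; the incidence numbers below depend on o s only up to even
   permutations. *)
Definition is_orientation K (o : {set T} -> seq T) : Prop :=
  forall s, s \in K -> uniq (o s) /\ o s =i s.

(* The permutation carrying the ordering u to the ordering v of the same
   vertices, extended by the identity outside u; it is unique when u is uniq.
   The default value 1 is irrelevant: it only occurs if u and v are not
   orderings of one set. *)
Definition perm_carrying (u v : seq T) : {perm T} :=
  odflt 1%g [pick p : {perm T} | perm_on [set:: u] p && (map p u == v)].

Variables (R : realType) (o : {set T} -> seq T).

(* [s : F] for #|F| = #|s|.+1; in that case s \subset F iff s = F :\ v for a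
   (unique) vertex v of F. *)
Definition incidence s F : R :=
  if [pick v in F | s == F :\ v] is Some v then
    (-1) ^+ index v (o F)
      * (-1) ^+ odd_perm (perm_carrying (rem v (o F)) (o s))
  else 0.

Definition boundary_mx K k : 'M[R]_(#|faces K k.-1|, #|faces K k|) :=
  \matrix_(i, j) incidence (enum_val i) (enum_val j).

(* L^up_(k-1) *)
Definition up_laplacian K k : 'M[R]_#|faces K k.-1| :=
  boundary_mx K k *m (boundary_mx K k)^T.

Definition eps F G : R := incidence (F :&: G) F * incidence (F :&: G) G.

Definition signed_adjacency_mx K k : 'M[R]_#|faces K k| :=
  \matrix_(i, j)
    let F : {set T} := enum_val i in let G : {set T} := enum_val j in
    if adjacent K k F G then eps F G else 0.

Definition fan_vector K k (rho : {set T}) : 'cV[R]_#|faces K k| :=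
  \col_i
    let F : {set T} := enum_val i in
    if rho \subset F then incidence rho F else 0.

End SimplicialComplexes.

Definition largest_eigenvalue (R : realType) (n : nat) (A : 'M[R]_n) (a : R)
    : Prop :=
  eigenvalue A a /\ forall b : R, eigenvalue A b -> b <= a.

(* Main.v *)
(* For [F] in the fan of [rho], each of the other [D - 1] fan members meets [F]
   in [rho] and contributes [x_rho F] to [(S x_rho) F], so the eigenvector
   equation always holds there.  A facet [F] outside the fan has a neighbour
   [v |: rho] in it only if, for a codimension-two face [tau] and a vertex [u],
   [rho = u |: tau] and [F] is [tau] with [v] and some [w] added; its neighbours
   in the fan are then among [v |: rho] and [w |: rho].  One neighbour
   contributes a sign to [(S x_rho) F], and the contributions of two cancel by
   the identity [B_(k-1) B_k = 0].
   For the last claim, [B^T B = (k + 1) I + S], so the Rayleigh quotient of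
   [B^T B] at a fan vector of degree [D] is [D + k], the largest eigenvalue;
   hence the fan vector is an eigenvector. *)
Require Import Defs.
From mathcomp Require Import all_boot all_order all_fingroup all_algebra.
From mathcomp Require Import reals.
From mathcomp Require Import complex lra ring.
Set Implicit Arguments.
Unset Strict Implicit.
Unset Printing Implicit Defensive.
Import Order.TTheory GRing.Theory Num.Theory.
Local Open Scope ring_scope.

(** * Rayleigh quotients and the largest eigenvalue *)

Section SymmetricForms.
Local Open Scope sesquilinear_scope.

(** Over the complex closure [A] is Hermitian, hence unitarily diagonalizable. Its eigenvalues are
    real, so they are eigenvalues of [A] over [R] and at most [a]; the form is then bounded term by
    term in an eigenbasis. *)
Lemma symmetric_form_le_eigenbound (R : rcfType) n (A : 'M[R]_n) (a : R)
    (v : 'rV_n) :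
    A^T = A -> (forall b, eigenvalue A b -> b <= a) ->
  (v *m A *m v^T) 0 0 <= a * (v *m v^T) 0 0.
Proof.
move=> Asym Ale.
pose toC := real_complex R; pose AC := map_mx toC A; pose vC := map_mx toC v.
have conjR m p (M : 'M[R]_(m, p)) :
    map_mx Num.conj (map_mx toC M) = map_mx toC M.
  apply/matrixP=> i j; rewrite !mxE; apply/CrealP.
  by apply/complex_realP; exists (M i j).
have ACherm : AC \is hermsymmx.
  by apply/is_hermitianmxP; rewrite expr0 scale1r map_trmx Asym conjR.
pose P := spectralmx AC; pose d := spectral_diag AC.
have Pu : P \is unitarymx := spectral_unitarymx AC.
have AE : AC = P^t* *m diag_mx d *m P.
  by rewrite -invmx_unitary //; apply/orthomx_spectralP/hermitian_normalmx.
(* Row [j] of [P] is an eigenvector for [d 0 j]; it is nonzero because the rows of a unitary matrix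
   have norm 1. *)
have d_le j : d 0 j <= toC a.
  have [b db] : exists b, d 0 j = toC b.
    have /mxOverP/(_ 0 j)/complex_realP[b db] :=
      hermitian_spectral_diag_real ACherm.
    by exists b.
  suff : eigenvalue AC (d 0 j) by rewrite db eigenvalue_map lecR; apply: Ale.
  apply/eigenvalueP; exists (row j P).
    rewrite AE -!row_mul !mulmxA (unitarymxP Pu) mul1mx.
    by rewrite row_mul row_diag_mx -scalemxAl -rowE.
  have /row_unitarymxP/(_ j j) := Pu; rewrite eqxx => Pj1.
  apply/eqP=> Pj0; move: Pj1; rewrite Pj0 dotmxE mul0mx mxE => /eqP.
  by rewrite eq_sym oner_eq0.
(* The coordinates of [v] in the eigenbasis. *)
pose w := vC *m P^t*.
have wE : w^t* = P *m vC^T.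
  by rewrite /w trmx_mul map_mxM trmxCK -map_trmx conjR.
have formA : toC ((v *m A *m v^T) 0 0) = \sum_j d 0 j * `|w 0 j| ^+ 2.
  transitivity ((w *m diag_mx d *m w^t*) 0 0).
    have -> : w *m diag_mx d *m w^t* = vC *m AC *m vC^T.
      by rewrite wE AE /w !mulmxA.
    by rewrite /vC map_trmx -!map_mxM [RHS]mxE.
  rewrite mxE; apply: eq_bigr => j _.
  by rewrite mul_mx_diag !mxE normCK mulrA [_ * d 0 j]mulrC.
have form1 : toC ((v *m v^T) 0 0) = \sum_j `|w 0 j| ^+ 2.
  transitivity ((w *m w^t*) 0 0).
    have -> : w *m w^t* = vC *m vC^T.
      by rewrite wE /w mulmxA mulmxKtV.
    by rewrite /vC map_trmx -!map_mxM [RHS]mxE.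
  by rewrite mxE; apply: eq_bigr => j _; rewrite !mxE normCK.
suff : toC ((v *m A *m v^T) 0 0) <= toC (a * (v *m v^T) 0 0) by rewrite lecR.
rewrite formA [toC _](rmorphM (real_complex R)) /= -/toC form1 mulr_sumr.
by apply: ler_sum => j _; rewrite ler_wpM2r // exprn_ge0.
Qed.

End SymmetricForms.

Lemma col_sqnorm_eq0 (R : realDomainType) n (x : 'cV[R]_n) :
  (x^T *m x) 0 0 <= 0 -> x = 0.
Proof.
rewrite mxE => x0; apply/colP=> i; rewrite mxE; apply/eqP.
have sq_ge0 j : true -> 0 <= x^T 0 j * x j 0.
  by rewrite mxE -expr2 sqr_ge0.
have /eqP : \sum_j x^T 0 j * x j 0 = 0 by apply/le_anti; rewrite x0 sumr_ge0.
rewrite psumr_eq0 // => /allP/(_ i).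
by rewrite mem_index_enum mxE mulf_eq0 orbb; apply.
Qed.

(* With [y = B x], [|B^T y - a x|^2 = |B^T y|^2 - 2 a |y|^2 + a^2 |x|^2
   <= a^2 |x|^2 - a |y|^2 = 0]. *)
Lemma gram_maximizer_eigenvector (R : rcfType) m n (B : 'M[R]_(m, n)) (a : R)
    (x : 'cV_n) :
    (forall b, eigenvalue (B *m B^T) b -> b <= a) ->
    (x^T *m (B^T *m B) *m x) 0 0 = a * (x^T *m x) 0 0 ->
  B^T *m B *m x = a *: x.
Proof.
move=> Ble xmax; pose y := B *m x.
have yE : (y^T *m y) 0 0 = a * (x^T *m x) 0 0.
  by rewrite -xmax /y trmx_mul !mulmxA.
(* The form of [B *m B^T] at [y] is [|B^T y|^2], so the bound reads [|B^T y|^2 <= a |y|^2]. *)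
have := symmetric_form_le_eigenbound y^T _ Ble.
rewrite trmxK trmx_mul trmxK => /(_ erefl) yle.
apply/eqP; rewrite -subr_eq0; apply/eqP/col_sqnorm_eq0.
rewrite -mulmxA -/y.
have -> : (B^T *m y - a *: x)^T = y^T *m B - a *: x^T.
  by rewrite linearB linearZ /= trmx_mul trmxK.
rewrite mulmxBl !mulmxBr -!scalemxAl -!scalemxAr.
have -> : y^T *m B *m x = y^T *m y by rewrite /y mulmxA.
have -> : x^T *m (B^T *m y) = y^T *m y by rewrite mulmxA -trmx_mul.
rewrite -!mulmxA in yle *.
move: yle yE; rewrite !mxE.
move=> yle yE; rewrite yE in yle *; lra.
Qed.

(** * Parity of reorderings of a vertex set *)

Section OrderingSign.
Variable T : finType.
Implicit Types (u v w : seq T) (p q : {perm T}).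

Lemma perm_carrying_exists u v :
  uniq u -> perm_eq u v ->
  exists2 p : {perm T}, perm_on [set:: u] p & map p u = v.
Proof.
move=> uu uv; have uniqv : uniq v by rewrite -(perm_uniq uv).
have szuv := perm_size uv; have memuv := perm_mem uv.
(* Each entry of [u] goes to the entry of [v] in the same position. *)
pose f x := if x \in u then nth x v (index x u) else x.
have f_mem x : (f x \in u) = (x \in u).
  rewrite /f; case: ifP => // xu; rewrite memuv mem_nth // -szuv.
  by rewrite index_mem.
have f_inj : injective f.
  move=> x y fxy; have := f_mem x; rewrite fxy f_mem.
  move: fxy; rewrite /f; case: ifP => xu; case: ifP => yu // + _.
  rewrite (set_nth_default y x) -?szuv ?index_mem // => /eqP.
  rewrite nth_uniq -?szuv ?index_mem // => /eqP.
  exact: index_inj.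
exists (perm f_inj).
  by apply/subsetP=> x; rewrite !inE permE /f; case: ifP => //; rewrite eqxx.
case: u => [|x0 u] in uu uv szuv memuv f f_mem f_inj *.
  by move/eqP: szuv; rewrite eq_sym size_eq0 => /eqP->.
apply: (@eq_from_nth _ x0); rewrite size_map // => i ilt.
rewrite (nth_map x0) // permE /f mem_nth // index_uniq //.
by apply: set_nth_default; rewrite -szuv.
Qed.

Lemma perm_carrying_unique u p q :
  perm_on [set:: u] p -> perm_on [set:: u] q -> map p u = map q u -> p = q.
Proof.
move=> pon qon /eq_in_map pq; apply/permP=> x.
case: (boolP (x \in u)) => [/pq //|xu].
by rewrite !(out_perm _ (_ : x \notin [set:: u])) ?inE.
Qed.

(** Existence keeps the choice in [perm_carrying] away from its default value. *)
Lemma perm_carryingP u v : uniq u -> perm_eq u v ->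
  perm_on [set:: u] (perm_carrying u v) /\ map (perm_carrying u v) u = v.
Proof.
move=> uu uv; rewrite /perm_carrying; case: pickP => [p /andP[pon /eqP//]|no].
have [p pon pv] := perm_carrying_exists uu uv.
by have := no p; rewrite pon pv eqxx.
Qed.

(** By uniqueness, a parity can be computed from any explicit permutation with these two
    properties. *)
Lemma perm_carryingE u v p : uniq u ->
  perm_on [set:: u] p -> map p u = v -> perm_carrying u v = p.
Proof.
move=> uu pon <-.
have puu : perm_eq u (map p u).
  apply: uniq_perm => //; first by rewrite map_inj_uniq //; exact: perm_inj.
  have im : [set:: u] = p @: [set:: u] by rewrite im_perm_on.
  move=> x; have := congr1 (fun A : {set T} => x \in A) im; rewrite !inE => ->.
  apply/imsetP/mapP => -[y]; rewrite ?inE => yu ->; exists y; rewrite ?inE //.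
have [pon' /perm_carrying_unique] := perm_carryingP uu puu.
exact.
Qed.

(** The value is [true] for odd reorderings, so signs compose by exclusive or and serve as exponents
    of -1. *)
Definition ordering_sign u v : bool := odd_perm (perm_carrying u v).

Lemma ordering_sign_trans u v w : uniq u -> perm_eq u v -> perm_eq v w ->
  ordering_sign u w = ordering_sign u v (+) ordering_sign v w.
Proof.
move=> uu uv vw; have uv' : uniq v by rewrite -(perm_uniq uv).
have [pon pE] := perm_carryingP uu uv.
have [qon qE] := perm_carryingP uv' vw.
have eqset : [set:: v] = [set:: u].
  by apply/setP=> x; rewrite !inE (perm_mem uv).
rewrite -odd_permM; congr odd_perm; apply: perm_carryingE => //.
  by apply: perm_onM => //; rewrite -eqset.
transitivity (map (perm_carrying v w) (map (perm_carrying u v) u)).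
  by rewrite -map_comp; apply: eq_map => x; exact: permM.
by rewrite pE qE.
Qed.

Lemma ordering_signxx u : uniq u -> ordering_sign u u = false.
Proof.
move=> uu; rewrite /ordering_sign (perm_carryingE (p := 1%g)) ?odd_perm1 //.
  exact: perm_on1.
by rewrite -[RHS]map_id; apply: eq_map => x; rewrite perm1.
Qed.

Lemma ordering_sign_cons x u v : uniq (x :: u) -> perm_eq u v ->
  ordering_sign (x :: u) (x :: v) = ordering_sign u v.
Proof.
move=> /[dup] xuu /= /andP[xu uu] uv; have [pon pE] := perm_carryingP uu uv.
congr odd_perm; apply: perm_carryingE => //.
  apply: subset_trans pon _; apply/subsetP=> y.
  by rewrite !inE => ->; rewrite orbT.
by rewrite /= pE (out_perm pon) // inE.
Qed.

Lemma ordering_sign_swap x y u : uniq [:: x, y & u] ->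
  ordering_sign [:: x, y & u] [:: y, x & u].
Proof.
move=> /[dup] uu /=; rewrite inE negb_or => /and3P[/andP[xy xu] yu _].
rewrite /ordering_sign (perm_carryingE (p := tperm x y)) ?odd_tperm //.
  apply: subset_trans (tperm_on x y) _; apply/subsetP=> z.
  by rewrite !inE => /orP[] ->; rewrite ?orbT.
rewrite /= tpermL tpermR; congr [:: _, _ & _].
rewrite -[RHS]map_id; apply/eq_in_map => z zu.
by rewrite tpermD //; apply: contraTneq zu => <-.
Qed.

(** Bringing [x] to the front moves it past the [index x u] entries before it, one transposition
    each. *)
Lemma ordering_sign_rem x u : uniq u -> x \in u ->
  ordering_sign u (x :: rem x u) = odd (index x u).
Proof.
elim: u => // y u IHu /[dup] yuu /= /andP[yu uu]; rewrite inE eq_sym.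
have [-> _|xy /= xu] := eqVneq x y; first by rewrite ordering_signxx.
have perm1 : perm_eq (y :: u) [:: y, x & rem x u].
  by rewrite perm_cons perm_to_rem.
rewrite (ordering_sign_trans (v := [:: y, x & rem x u])) //; last first.
  by rewrite (perm_catCA [:: y] [:: x]).
rewrite ordering_sign_cons ?perm_to_rem // IHu //.
by rewrite ordering_sign_swap ?addbT // -(perm_uniq perm1).
Qed.

End OrderingSign.

(** * Incidence numbers and the boundary identity *)

Section SignedAdjacency.
Variables (R : realType) (T : finType).
Variables (K : {set {set T}}) (o : {set T} -> seq T).
Hypotheses (hK : simplicial_complex K) (ho : is_orientation K o).
Implicit Types (s F G rho tau : {set T}) (u v w : T).

Local Notation inc := (incidence R o).

(** The sign for the position of [v] and the sign for reordering the remaining vertices merge into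
    the parity of a single reordering, which makes products of incidence numbers composable. *)
Lemma incidence_setU1 s v : v \notin s -> v |: s \in K ->
  inc s (v |: s) = (-1) ^+ ordering_sign (o (v |: s)) (v :: o s).
Proof.
move=> vs vsK; have sK : s \in K by apply: hK vsK _; exact: subsetUr.
have [Fu Fm] := ho vsK; have [su sm] := ho sK.
have vF : v \in o (v |: s) by rewrite Fm !inE eqxx.
have remE : perm_eq (rem v (o (v |: s))) (o s).
  apply: uniq_perm => //; first exact: rem_uniq.
  move=> x; rewrite mem_rem_uniq // !inE Fm sm !inE.
  by have [->|//] := eqVneq x v; rewrite (negPf vs).
rewrite /incidence; case: pickP => [x /andP[xF /eqP sE]|/(_ v)]; last first.
  by rewrite setU1K // !inE !eqxx.
have -> : x = v.
  by have := vs; rewrite sE !inE eqxx andbT negbK => /eqP->.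
rewrite (ordering_sign_trans (v := v :: rem v (o (v |: s)))) //.
- rewrite ordering_sign_rem // ordering_sign_cons //.
    by rewrite signr_addb signr_odd.
  by rewrite -(perm_uniq (perm_to_rem vF)).
- exact: perm_to_rem.
- by rewrite perm_cons.
Qed.

Lemma incidence_sub_eq0 s F : ~~ (s \subset F) -> inc s F = 0.
Proof.
rewrite /incidence; case: pickP => // v /andP[_ /eqP->].
by rewrite subsetDl.
Qed.

(* An entry of the matrix identity [B_(j-1) B_j = 0]. *)
Lemma incidence_boundary2 tau u v :
    u \notin tau -> v \notin tau -> u != v -> v |: (u |: tau) \in K ->
  inc tau (u |: tau) * inc (u |: tau) (v |: (u |: tau))
    = - (inc tau (v |: tau) * inc (v |: tau) (v |: (u |: tau))).
Proof.
move=> ut vt uv FK; have FE : v |: (u |: tau) = u |: (v |: tau).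
  by rewrite setUCA.
(* Two successive incidences compose to one reordering of the top face that puts the two added
   vertices in front. *)
have expand x y : x \notin tau -> y \notin tau -> x != y ->
    y |: (x |: tau) \in K ->
  inc tau (x |: tau) * inc (x |: tau) (y |: (x |: tau))
    = (-1) ^+ ordering_sign (o (y |: (x |: tau))) [:: y, x & o tau].
  move=> xt yt xy yxK.
  have xK : x |: tau \in K by apply: hK yxK _; exact: subsetUr.
  have tK : tau \in K by apply: hK xK _; exact: subsetUr.
  have yx : y \notin x |: tau by rewrite !inE eq_sym (negPf xy).
  rewrite !incidence_setU1 // -signr_addb addbC.
  have [[u1 m1] [u2 m2] [u3 m3]] := And3 (ho yxK) (ho xK) (ho tK).
  have perm2 : perm_eq (o (x |: tau)) (x :: o tau).
    apply: uniq_perm; rewrite //= ?u3 ?m3 ?xt // => z.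
    by rewrite m2 !inE m3.
  have uniq2 : uniq (y :: o (x |: tau)) by rewrite /= m2 yx.
  rewrite -(ordering_sign_cons uniq2 perm2) -ordering_sign_trans //.
    apply: uniq_perm => // z; by rewrite m1 !inE m2 !inE.
  by rewrite perm_cons.
have [oFu oFm] := ho FK.
have [otu otm] : uniq (o tau) /\ o tau =i tau.
  by apply/ho/(hK FK); rewrite setUA subsetUr.
have uvt : uniq [:: v, u & o tau].
  by rewrite /= inE !otm negb_or eq_sym uv vt ut.
rewrite expand // FE expand -?FE 1?eq_sym //.
(* The two sides differ by exchanging the two leading vertices, which is odd. *)
rewrite [in RHS](ordering_sign_trans (v := [:: v, u & o tau])) //.
- by rewrite ordering_sign_swap // addbT signrN opprK.
- by apply: uniq_perm => // z; rewrite oFm !inE otm.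
- by rewrite (perm_catCA [:: v] [:: u]).
Qed.

(** * Ridges inside facets *)

Variable (k : nat).
Hypothesis (hk : (1 <= k)%N).

Lemma ridge_subset_facet rho F : rho \in faces K k.-1 -> F \in faces K k ->
  rho \subset F -> exists2 v, v \notin rho & F = v |: rho.
Proof.
rewrite !inE prednK // => /andP[_ /eqP rhok] /andP[_ /eqP Fk] sub.
have /cards1P[v vE] : #|F :\: rho| == 1%N.
  by rewrite cardsD (setIidPr sub) Fk rhok subSnn.
have := set11 v; rewrite -vE inE => /andP[vr vF]; exists v => //.
by rewrite -vE setUC setDE setUIr setUCr setIT (setUidPr sub).
Qed.

Lemma incidence_sqr rho F : rho \in faces K k.-1 -> F \in faces K k ->
  inc rho F * inc rho F = (rho \subset F)%:R.
Proof.
move=> rhoK FK; have [sub|nsub] := boolP (rho \subset F); last first.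
  by rewrite incidence_sub_eq0 // mul0r.
have [v vr FE] := ridge_subset_facet rhoK FK sub.
move: FK; rewrite FE inE => /andP[FK _].
by rewrite incidence_setU1 // -expr2 sqrr_sign.
Qed.

Lemma incidence_neq0 rho F : rho \in faces K k.-1 -> F \in faces K k ->
  rho \subset F -> inc rho F != 0.
Proof.
move=> rhoK FK sub; have := incidence_sqr rhoK FK; rewrite sub => sq.
by apply: contraTneq (oner_neq0 R) => inc0; rewrite -[1]sq inc0 mul0r eqxx.
Qed.

(** Distinct facets share at most [k] vertices, and [rho] already has [k]. *)
Lemma setI_facets rho F G :
    rho \in faces K k.-1 -> F \in faces K k -> G \in faces K k -> F != G ->
    rho \subset F -> rho \subset G -> F :&: G = rho.
Proof.
move=> rhoK FK GK FG rF rG; apply/esym/eqP.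
rewrite eqEcard subsetI rF rG /=.
move: rhoK FK GK; rewrite !inE prednK //.
move=> /andP[_ /eqP->] /andP[_ /eqP Fk] /andP[_ /eqP Gk].
rewrite -ltnS -Fk; apply: proper_card; rewrite properEneq subsetIl andbT.
apply: contra FG => /eqP/setIidPl FsG.
by rewrite eqEcard FsG Fk Gk leqnn.
Qed.

(** * Action of the signed adjacency matrix on a fan vector *)

Definition fan_neighbors rho F := [set G in fan K k rho | adjacent K k F G].

(** This is the entry of [S x_rho] at [F], summed over sets rather than matrix indices. *)
Definition fan_action rho F : R :=
  \sum_(G in fan_neighbors rho F) eps R o F G * inc rho G.

(** Every other fan member [G] meets [F] in [rho], so its term is [[rho:F] [rho:G]^2 = [rho:F]]. *)
Lemma fan_action_in rho F : rho \in faces K k.-1 -> F \in fan K k rho ->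
  fan_action rho F = ((upper_degree K k rho)%:R - 1) * inc rho F.
Proof.
move=> rhoK Ffan; have := Ffan; rewrite inE => /andP[FK rF].
have nbE : fan_neighbors rho F = fan K k rho :\ F.
  apply/setP=> G; rewrite in_set [RHS]in_set in_set1 andbC /adjacent eq_sym.
  case: (boolP (G \in fan K k rho)); rewrite ?andbF // !andbT.
  rewrite inE => /andP[GK rG]; have [//|GF /=] := eqVneq G F.
  by rewrite (setI_facets rhoK) // eq_sym.
rewrite /fan_action nbE.
rewrite (eq_bigr (fun _ => inc rho F)); last first.
  move=> G; rewrite in_setD1 inE => /and3P[GF GK rG].
  rewrite /eps (setI_facets rhoK) // 1?eq_sym // -mulrA incidence_sqr //.
  by rewrite rG mulr1.
rewrite sumr_const -[LHS]mulr_natl /upper_degree (cardsD1 F (fan K k rho)) Ffan.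
by rewrite natrD addrAC subrr add0r.
Qed.

(** Take [tau] to be [F :&: rho], [u] the vertex of [rho] outside [F], [v] the vertex of [G] outside
    [rho], and [w] the vertex of [F] outside [G]. *)
Lemma fan_neighbor_shape rho F G :
    rho \in faces K k.-1 -> F \in faces K k -> ~~ (rho \subset F) ->
    G \in fan_neighbors rho F ->
  exists tau u v w,
    [/\ uniq [:: u; v; w], [&& u \notin tau, v \notin tau & w \notin tau],
        rho = u |: tau, G = v |: rho & F = w |: (v |: tau)].
Proof.
move=> rhoK FK nrF; rewrite in_set => /andP[].
rewrite in_set => /andP[GK rG] /andP[FG FGridge].
have [v vr GE] := ridge_subset_facet rhoK GK rG.
have [w wFG FE] := ridge_subset_facet FGridge FK (subsetIl F G).
(* Otherwise the ridge [F :&: G] lies in [rho], equals it by cardinality, and puts [rho] inside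
   [F]. *)
have vF : v \in F.
  apply: contraNT nrF => vF; suff -> : rho = F :&: G by exact: subsetIl.
  apply/esym/eqP; rewrite eqEcard; apply/andP; split.
    apply/subsetP=> x; rewrite GE !inE => /andP[xF /orP[/eqP xv|//]].
    by rewrite -xv xF in vF.
  by move: rhoK FGridge; rewrite !inE => /andP[_ /eqP->] /andP[_ /eqP->].
have FGE : F :&: G = v |: (F :&: rho).
  apply/setP=> x; rewrite GE !inE; have [->|//] := eqVneq x v.
  by rewrite vF.
have vt : v \notin F :&: rho by rewrite inE (negPf vr) andbF.
(* The ridge [F :&: G] has [k] vertices, one of them [v], so [F :&: rho] has one vertex fewer than
   [rho]. *)
have /cards1P[u uE] : #|rho :\: F| == 1%N.
  rewrite cardsD setIC; move: FGridge; rewrite FGE inE => /andP[_].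
  rewrite cardsU1 vt; move: rhoK; rewrite inE => /andP[_ /eqP->].
  by rewrite eqSS => /eqP->; rewrite subSnn.
have := set11 u; rewrite -uE inE => /andP[uF ur].
have wF : w \in F by rewrite FE !inE eqxx.
have wv : w != v by apply: contraNneq wFG => ->; rewrite FGE !inE eqxx.
have wr : w \notin rho.
  by apply: contraNN wFG => wr; rewrite FGE !inE wF wr orbT.
exists (F :&: rho), u, v, w; split=> //.
- rewrite /= !inE negb_or andbT [v == w]eq_sym wv andbT.
  by apply/andP; split; apply: contraNneq uF => ->.
- by rewrite !inE (negPf uF) (negPf vr) (negPf wr) !andbF.
- by rewrite -uE [F :&: rho]setIC setUC setID.
- by rewrite -FGE.
Qed.

Lemma fan_action_out rho F :
    rho \in faces K k.-1 -> F \in faces K k -> ~~ (rho \subset F) ->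
  let m := #|fan_neighbors rho F| in
  m = 0%N \/ m = 2%N <-> fan_action rho F = 0.
Proof.
move=> rhoK FK nrF /=.
have [nb0|[G Gnb]] := set_0Vmem (fan_neighbors rho F).
  by rewrite /fan_action nb0 cards0 big_set0; split=> // _; left.
have [tau [u [v [w [uvw ntau rhoE GE FE]]]]] :=
  fan_neighbor_shape rhoK FK nrF Gnb.
move: uvw; rewrite /= !inE negb_or andbT => /andP[/andP[uv uw] vw].
case/and3P: ntau => ut vt wt.
(* The vertex that [H] adds to [rho] lies in [F] but not in [rho], which leaves only [v] and [w]. *)
have nbP H : H \in fan_neighbors rho F -> H = v |: rho \/ H = w |: rho.
  move=> Hnb; have [tau' [u' [x [y [uxy nt' rhoE' HE FE']]]]] :=
    fan_neighbor_shape rhoK FK nrF Hnb.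
  have : x \in F by rewrite FE' !inE eqxx orbT.
  have : x \notin rho.
    rewrite rhoE' inE in_set1 negb_or; case/and3P: nt' => _ -> _.
    by rewrite eq_sym; move: uxy; rewrite /= !inE negb_or; case: eqP.
  rewrite HE FE rhoE !inE negb_or => /andP[_ /negPf->]; rewrite orbF.
  by case/orP=> /eqP->; [right | left].
have FinK : F \in K by move: FK; rewrite inE => /andP[].
(* Since [G = v |: rho] is a neighbour, the count is two or one according to whether [w |: rho] is a
   neighbour as well. *)
have [wnb|wnb] := boolP (w |: rho \in fan_neighbors rho F); last first.
  have nbE : fan_neighbors rho F = [set G].
    apply/setP=> H; rewrite [RHS]in_set1; apply/idP/eqP => [Hnb|-> //].
    by have [->|HE] := nbP H Hnb; [rewrite GE | rewrite -HE Hnb in wnb].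
  rewrite /fan_action nbE cards1 big_set1; split; first by case.
  move: Gnb; rewrite in_set => /andP[].
  rewrite in_set => /andP[GK rG] /andP[FG FGridge].
  (* The only summand is a product of nonzero incidence numbers. *)
  move/eqP; rewrite /eps !mulf_eq0.
  by rewrite !(negPf (incidence_neq0 _ _ _)) ?subsetIl ?subsetIr.
have vw_rho : v |: rho != w |: rho.
  apply/negP=> /eqP/setP/(_ v); rewrite rhoE !inE eqxx (negPf vw) (negPf vt).
  by rewrite eq_sym (negPf uv).
have nbE : fan_neighbors rho F = [set v |: rho; w |: rho].
  apply/setP=> H; rewrite [RHS]in_set2; apply/idP/orP.
    by move=> Hnb; have [->|->] := nbP H Hnb; [left | right].
  by case=> /eqP-> //; rewrite -GE.
have [GinK wK] : v |: rho \in K /\ w |: rho \in K.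
  by move: Gnb wnb; rewrite GE !inE; do 2!case/andP=> /andP[/andP[-> _] _] _.
split=> _; last by right; rewrite nbE cards2 vw_rho.
rewrite /fan_action nbE big_setU1 ?inE //= big_set1 /eps.
have FIv : F :&: (v |: rho) = v |: tau.
  apply/setP=> x; rewrite FE rhoE !inE.
  have [->|_] := eqVneq x v; first by rewrite orbT.
  have [->|_] /= := eqVneq x w; first by rewrite eq_sym (negPf uw) (negPf wt).
  by case: (x \in tau); rewrite ?orbT.
have FIw : F :&: (w |: rho) = w |: tau.
  apply/setP=> x; rewrite FE rhoE !inE.
  have [->|_] := eqVneq x w; first by [].
  have [->|_] /= := eqVneq x v; first by rewrite eq_sym (negPf uv) (negPf vt).
  by case: (x \in tau); rewrite ?orbT.
rewrite FIv FIw.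
have sq x s : x \notin s -> x |: s \in K -> inc s (x |: s) ^+ 2 = 1.
  by move=> xs xsK; rewrite incidence_setU1 // sqrr_sign.
have dv := incidence_boundary2 ut vt uv; rewrite -rhoE in dv.
have dw := incidence_boundary2 ut wt uw; rewrite -rhoE in dw.
have dF := incidence_boundary2 vt wt vw; rewrite -FE in dF.
have [vr wr] : v \notin rho /\ w \notin rho.
  by rewrite rhoE !inE ![_ == u]eq_sym (negPf uv) (negPf uw).
have sqe := sq _ _ vr GinK; have sqf := sq _ _ wr wK.
(* Since signs square to 1, the boundary identity for [tau] in [v |: rho] becomes [[v tau : v rho]
   [rho : v rho] = - [tau : v tau] [tau : rho]]; likewise with [w]. *)
have flip (a c e p : R) : p ^+ 2 = 1 -> e ^+ 2 = 1 -> a * e = - (p * c) ->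
    c * e = - (p * a).
  move=> p1 e1 ae; transitivity (p * (p * c) * e).
    by rewrite mulrA -expr2 p1 mul1r.
  by rewrite -[p * c]opprK -ae mulrN mulNr -!mulrA -expr2 e1 mulr1.
have sqv : inc tau (v |: tau) ^+ 2 = 1.
  by apply: sq => //; rewrite -FIv; apply: hK FinK _; exact: subsetIl.
have sqw : inc tau (w |: tau) ^+ 2 = 1.
  by apply: sq => //; rewrite -FIw; apply: hK FinK _; exact: subsetIl.
rewrite -!mulrA (flip _ _ _ _ sqv sqe (dv GinK)) (flip _ _ _ _ sqw sqf (dw wK)).
(* With [- [tau : rho]] factored out, what remains is the boundary identity for [tau] in [F]. *)
transitivity (- inc tau rho * (inc tau (v |: tau) * inc (v |: tau) F
  + inc tau (w |: tau) * inc (w |: tau) F)); first by ring.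
by rewrite (dF FinK) addNr mulr0.
Qed.

Lemma signed_adjacency_mul_fan rho (i : 'I_#|faces K k|) :
  (signed_adjacency_mx R o K k *m fan_vector R o K k rho) i 0
    = fan_action rho (enum_val i).
Proof.
pose f G : R :=
  (if adjacent K k (enum_val i) G then eps R o (enum_val i) G else 0) *
  (if rho \subset G then inc rho G else 0).
transitivity (\sum_(G in faces K k) f G).
  by rewrite big_enum_val mxE; apply: eq_bigr => j _; rewrite !mxE /=.
rewrite /fan_action [LHS]big_mkcond [RHS]big_mkcond; apply: eq_bigr => G _.
rewrite [G \in fan_neighbors _ _]in_set [G \in fan _ _ _]in_set /f.
by case: (G \in faces K k); case: (rho \subset G); case: adjacent;
  rewrite ?mulr0 ?mul0r.
Qed.

(** The equation is read entry by entry: on the fan it holds by [fan_action_in], and off the fan its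
    right side is 0, so [fan_action_out] applies. *)
Lemma clean_iff_eigenvector rho : rho \in faces K k.-1 ->
  clean K k rho <->
  signed_adjacency_mx R o K k *m fan_vector R o K k rho
    = ((upper_degree K k rho)%:R - 1) *: fan_vector R o K k rho.
Proof.
move=> rhoK; split=> [cl | Sx F FK].
  apply/colP=> i; rewrite signed_adjacency_mul_fan !mxE /=.
  have FK := enum_valP i; have [rF|nrF] := boolP (rho \subset enum_val i).
    by apply: fan_action_in; rewrite // in_set FK.
  rewrite mulr0; apply/fan_action_out => //.
  by apply: cl => //; rewrite in_set (negPf nrF) andbF.
rewrite in_set FK /= => nrF.
apply/(fan_action_out rhoK FK nrF).
have := congr1 (fun x : 'cV_#|faces K k| => x (enum_rank_in FK F) 0) Sx.
rewrite signed_adjacency_mul_fan !mxE /= enum_rankK_in // (negPf nrF) mulr0.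
exact.
Qed.

(** Entries of [S x] off the fan meet zeros of [x], so [fan_action_in] determines the form. *)
Lemma fan_vector_form rho : rho \in faces K k.-1 ->
  let x := fan_vector R o K k rho in
  (x^T *m signed_adjacency_mx R o K k *m x) 0 0
    = ((upper_degree K k rho)%:R - 1) * (x^T *m x) 0 0.
Proof.
move=> rhoK x; rewrite -mulmxA mxE [in RHS]mxE mulr_sumr; apply: eq_bigr => i _.
rewrite signed_adjacency_mul_fan /x !mxE /=; have FK := enum_valP i.
have [rF|nrF] := ifPn; last by rewrite !mul0r mulr0.
have Ffan : enum_val i \in fan K k rho by rewrite in_set FK.
by rewrite (fan_action_in rhoK Ffan) mulrCA.
Qed.

(** * Gram matrix of the boundary *)

Lemma card_ridges F : F \in faces K k ->
  #|[set s in faces K k.-1 | s \subset F]| = k.+1.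
Proof.
rewrite inE => /andP[FK /eqP Fk].
have -> : [set s in faces K k.-1 | s \subset F]
    = [set s : {set T} | s \subset F & #|s| == k].
  apply/setP=> s; rewrite !inE prednK // andbC.
  have [sF|//] := boolP (s \subset F).
  by rewrite (hK FK sF).
by rewrite cards_draws Fk binSn.
Qed.

(** A diagonal entry counts the [k + 1] ridges of a facet. Off the diagonal the only possible common
    ridge of [F] and [G] is [F :&: G], which contributes [eps]. *)
Lemma boundary_gram :
  (boundary_mx R o K k)^T *m boundary_mx R o K k
    = k.+1%:R%:M + signed_adjacency_mx R o K k.
Proof.
apply/matrixP=> i j.
transitivity (\sum_(s in faces K k.-1) inc s (enum_val i) * inc s (enum_val j)).
  by rewrite big_enum_val mxE; apply: eq_bigr => l _; rewrite !mxE /=.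
have FK := enum_valP i; have GK := enum_valP j; rewrite !mxE /=.
have [-> {i FK}|ij] := eqVneq i j.
  rewrite /adjacent eqxx addr0 -(card_ridges GK) -sum1_card natr_sum.
  rewrite mulr1n [LHS]big_mkcond [RHS]big_mkcond. apply: eq_bigr => s _.
  rewrite in_set; case: ifP => //= sK; rewrite incidence_sqr //.
  by case: (s \subset _).
have FG : enum_val i != enum_val j by apply: contraNneq ij => /enum_val_inj->.
rewrite mulr0n add0r /adjacent FG /=.
have zero s : s \in faces K k.-1 -> s != enum_val i :&: enum_val j ->
    inc s (enum_val i) * inc s (enum_val j) = 0.
  move=> sK; have [sF|sF] := boolP (s \subset enum_val i); last first.
    by rewrite incidence_sub_eq0 // mul0r.
  have [sG|sG] := boolP (s \subset enum_val j); last first.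
    by rewrite mulrC incidence_sub_eq0 // mul0r.
  by rewrite (setI_facets sK FK GK) // eqxx.
case: ifPn => [IK|nIK]; last first.
  rewrite big1 // => s sK; apply: zero => //.
  by apply: contraNneq nIK => <-.
by rewrite (bigD1 _ IK) /= big1 ?addr0 // => s /andP[]; exact: zero.
Qed.

End SignedAdjacency.

(** * Cleanness from the eigenvector equation and the extremal eigenvalue *)

Theorem proposition4p11 (R : realType) (T : finType) (K : {set {set T}})
    (k D : nat) (o : {set T} -> seq T)
    (hK : simplicial_complex K) (hdim : has_dim K k) (hk : (1 <= k)%N)
    (ho : is_orientation K o) (hD : D = max_upper_degree K k) :
  (forall rho : {set T},
     rho \in faces K k.-1 -> upper_degree K k rho = D ->
     (clean K k rho <->
      signed_adjacency_mx R o K k *m fan_vector R o K k rho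
        = (D%:R - 1) *: fan_vector R o K k rho))
  /\
  (largest_eigenvalue (up_laplacian R o K k) (D + k)%:R ->
   forall rho : {set T},
     rho \in faces K k.-1 -> upper_degree K k rho = D -> clean K k rho).
Proof.
split=> [rho rhoK <-|[_ Lle] rho rhoK rhoD]; first exact: clean_iff_eigenvector.
apply/(clean_iff_eigenvector R hK ho hk rhoK); rewrite rhoD.
have xform : let x := fan_vector R o K k rho in
    (x^T *m ((boundary_mx R o K k)^T *m boundary_mx R o K k) *m x) 0 0
      = (D + k)%:R * (x^T *m x) 0 0.
  move=> x; rewrite (boundary_gram R hK ho hk) mulmxDr mulmxDl mul_mx_scalar.
  rewrite -scalemxAl mxE (fan_vector_form R hK ho hk rhoK) rhoD mxE -mulrDl.
  by congr (_ * _); rewrite natrD -natr1; ring.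
have := gram_maximizer_eigenvector Lle xform.
rewrite (boundary_gram R hK ho hk) mulmxDl mul_scalar_mx => /eqP.
(* Subtracting the scalar part of [B^T B] leaves the eigenvalue [(D + k) - (k + 1) = D - 1] for
   [S]. *)
rewrite addrC eq_sym -subr_eq -scalerBl => /eqP <-.
by congr (_ *: _); rewrite natrD -natr1; ring.
Qed.
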